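(* There exists a Meyerian point process $\Lambda$ in $\mathbb{R}$ which is $2$-syndetic in a random translate of $\mathbb{Z}$ (i.e. almost surely there is $t\in\mathbb{R}$ such that $\Lambda+t$ is a $2$-syndetic subset of $\mathbb{Z}$) and for which the asymptotic number variance $$\mathrm{ANV}(\Lambda)=\lim_{R\to\infty}\frac{\mathrm{Var}(\#(\Lambda\cap[-R,R]))}{2R}$$ exists and is strictly positive.
   Context: A set $P\subset\mathbb{R}^d$ is a Meyer set if it is relatively dense ($P+K=\mathbb{R}^d$ for some compact $K$) and $P-P$ is uniformly discrete. A Meyerian point process in $\mathbb{R}^d$ is an ergodic (translation-)invariant simple point process in $\mathbb{R}^d$ whose realizations are Meyer sets; that is, an $\mathbb{R}^d$-equivariant measurable map $\omega\mapsto\Lambda_\omega$ from a standard probability space $(\Omega,\mathbb{P})$ with an ergodic probability-measure-preserving $\mathbb{R}^d$-action into the locally finite subsets of $\mathbb{R}^d$ (with $\mathbb{R}^d$ acting by translations), taking Meyer sets as values. A subset of $\mathbb{Z}$ is $2$-syndetic if two of its translates (by integers) cover $\mathbb{Z}$. *)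

(* Defs.v *)
From HB Require Import structures.
From mathcomp Require Import all_boot all_order all_algebra finmap.
From mathcomp Require Import all_classical all_reals all_analysis.

Set Implicit Arguments.
Unset Strict Implicit.
Unset Printing Implicit Defensive.

Import Order.TTheory GRing.Theory Num.Theory.
Import numFieldNormedType.Exports.

Local Open Scope classical_set_scope.
Local Open Scope ring_scope.

Section subsets_of_the_line.
Context {R : realType}.
Implicit Types P Q : set R.

Definition translate P (t : R) : set R := [set x + t | x in P].

Definition difference_set P : set R := [set x - y | x in P & y in P].

Definition relatively_dense P : Prop :=
  exists2 K : set R, compact K & [set x + k | x in P & k in K] = setT.

Definition uniformly_discrete P : Prop :=
  exists2 r : R, 0 < r & forall x y, P x -> P y -> x != y -> r <= `|x - y|.

Definition meyer_set P : Prop :=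
  relatively_dense P /\ uniformly_discrete (difference_set P).

Definition locally_finite P : Prop :=
  forall K : set R, compact K -> finite_set (P `&` K).

End subsets_of_the_line.

Definition two_syndetic (S : set int) : Prop :=
  exists m1 m2 : int, [set n + m1 | n in S] `|` [set n + m2 | n in S] = setT.

Record lfset (R : realType) := LFSet {
  lfset_set :> set R ;
  lfset_locally_finite : locally_finite lfset_set }.

Lemma locally_finite0 (R : realType) : locally_finite (set0 : set R).
Proof. by move=> K _; rewrite set0I; exact: finite_set0. Qed.

HB.instance Definition _ (R : realType) := gen_eqMixin (lfset R).
HB.instance Definition _ (R : realType) := gen_choiceMixin (lfset R).
HB.instance Definition _ (R : realType) :=
  isPointed.Build (lfset R) (LFSet (@locally_finite0 R)).

(* [lfspace R] carries the usual sigma-algebra on locally finite sets,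
   generated by the maps S |-> #(S `&` B) for B bounded Borel. *)
Definition counting_events (R : realType) : set (set (lfset R)) :=
  [set E | exists (B : set (measurableTypeR R)) (n : nat),
    [/\ measurable B, bounded_set (B : set R) &
        E = [set S : lfset R | ((S : set R) `&` B #= `I_n)%card]]].

Notation lfspace R := (g_sigma_algebraType (@counting_events R)).

(* The sigma-algebra of T is the Borel sigma-algebra of a complete separable
   metric, which is transported to T along the bijection f. *)
Definition standard_borel (R : realType) d (T : measurableType d) : Prop :=
  exists (X : metricType R) (f : T -> X),
    [/\ (forall F : set_system X, ProperFilter F -> cauchy F ->
          exists x : X, F --> x),
        (exists2 D : set X, countable D & dense D),
        bijective f &
        @measurable d T = [set f @^-1` B | B in <<s @open X >>]].

Section point_processes.
Context {R : realType} {d : measure_display} {T : measurableType d}.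
Variables (P : probability T R) (act : R -> T -> T).

Record pmp_action : Prop := PmpAction {
  pmp_act0 : forall w, act 0 w = w ;
  pmp_actD : forall s t w, act (s + t) w = act s (act t w) ;
  pmp_measurable : measurable_fun [set: measurableTypeR R * T]
    (fun tw : measurableTypeR R * T => act tw.1 tw.2) ;
  pmp_preserving : forall t (A : set T), measurable A ->
    P (act t @^-1` A) = P A }.

Definition ergodic_action : Prop :=
  forall A : set T, measurable A -> (forall t, act t @^-1` A = A) ->
    P A = 0%E \/ P A = 1%E.

Variable L : T -> lfset R.

Record meyerian_point_process : Prop := MeyerianPointProcess {
  mpp_standard : standard_borel R T ;
  mpp_pmp : pmp_action ;
  mpp_ergodic : ergodic_action ;
  mpp_measurable : measurable_fun [set: T] (L : T -> lfspace R) ;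
  mpp_equivariant : forall t w,
    lfset_set (L (act t w)) = translate (L w) t ;
  mpp_meyer : forall w, meyer_set (L w) }.

Definition point_count (r : R) (w : T) : R :=
  #|` fset_set (L w `&` `[- r, r]) |%:R.

Definition number_variance (r : R) : \bar R := variance P (point_count r).

Definition has_asymptotic_number_variance (v : R) : Prop :=
  (number_variance r * ((2 * r)^-1)%:E)%E @[r --> +oo] --> v%:E.

Definition two_syndetic_in_random_translate : Prop :=
  {ae P, forall w, exists (t : R) (S : set int),
    two_syndetic S /\ translate (L w) t = [set n%:~R | n in S]}.

End point_processes.

(* Main.v *)
Require Import Defs.
From HB Require Import structures.
From mathcomp Require Import all_boot all_order all_algebra finmap.
From mathcomp Require Import all_classical all_reals all_analysis.
From mathcomp Require Import measurable_realfun.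
From mathcomp Require Import zify ring lra.

(** Thin the odd integers: keep all of [2Z] and keep each odd integer
    [2k + 1] independently with probability 1/2; then translate by a uniform
    random [2s]. Since [2Z] is kept, the realizations are Meyer and two
    translates cover [Z], while the fair coins give a window of length [2R] a
    variance [R/4 + O(sqrt R)], hence an asymptotic number variance 1/8.

    The flow is the suspension of the Bernoulli shift on [{0,1}^Z]. The fair
    coin measure is the law of the binary digits of a uniform variable. A
    shift-invariant event [A] is independent of every cylinder [C]: the events
    [A] and [T^-n C] have a covariance [delta] that does not depend on [n],
    whereas far apart translates of [C] are pairwise independent, so that
    Cauchy-Schwarz applied to [A] and the sum of [N] of them gives
    [(N delta)^2 <= N]. Hence [A] is independent of itself. *)

Set Implicit Arguments.
Unset Strict Implicit.
Unset Printing Implicit Defensive.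

Import Order.TTheory GRing.Theory Num.Theory.
Import numFieldNormedType.Exports.

Local Open Scope classical_set_scope.
Local Open Scope ring_scope.

(** * Binary digits *)

Lemma countType_bigcup_measurable d (T : measurableType d) (I : countType)
    (D : set I) (F : I -> set T) :
  (forall i, D i -> measurable (F i)) -> measurable (\bigcup_(i in D) F i).
Proof.
move=> mF; rewrite bigcup_mkcond; apply: countable_bigcupT_measurable => [|i].
  exact: countableP.
by case: ifPn => [/set_mem/mF//|_]; exact: measurable0.
Qed.

Section coin_tossing.
Context {R : realType}.
Local Notation leb := (@lebesgue_measure R).

Lemma floor_eq_itv (z : int) :
  [set u : R | Num.floor u = z] = `[z%:~R, z%:~R + 1[%classic.
Proof.
apply/seteqP; split => u /=; rewrite in_itv/=.
  by move=> <-; rewrite ge_floor/= -intrD1 lt_succ_floor.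
by move=> ?; apply/floor_def; rewrite intrD1.
Qed.

Lemma measurable_floor_eq d (T : measurableType d) (f : T -> R) (z : int) :
  measurable_fun setT (f : T -> measurableTypeR R) ->
  measurable [set w | Num.floor (f w) = z].
Proof.
move=> mf; have -> : [set w | Num.floor (f w) = z] =
    setT `&` f @^-1` [set u : R | Num.floor u = z] by rewrite setTI.
by apply: mf => //; rewrite floor_eq_itv; exact: measurable_itv.
Qed.

(** The binary digit of [u] at place [k + 1] after the point. The absolute value only turns the
    floor into a natural number; it does not change its parity. *)
Definition digit (k : nat) (u : R) : bool := odd `|Num.floor (2 ^+ k.+1 * u)|%N.

Lemma measurable_digit k : measurable [set u : measurableTypeR R | digit k u].
Proof.
have -> : [set u : measurableTypeR R | digit k u] =
    \bigcup_(z in [set z : int | odd `|z|%N])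
      [set u | Num.floor (2 ^+ k.+1 * u) = z].
  by apply/seteqP; split => [u du|u [z /= oz uz]];
    [exists (Num.floor (2 ^+ k.+1 * u))|rewrite /digit uz].
apply: countType_bigcup_measurable => z _; apply: measurable_floor_eq.
exact: measurable_realfun.mulrl_measurable.
Qed.

Definition dyadic (q j : nat) : set (measurableTypeR R) :=
  [set u | Num.floor (2 ^+ q * u) = j%:Z].

Lemma dyadicE q j :
  dyadic q j = `[2 ^- q * j%:R, 2 ^- q * (j%:R + 1)[%classic :> set R.
Proof.
have q0 : 0 < 2 ^+ q :> R by rewrite exprn_gt0.
apply/seteqP; split => u; rewrite /dyadic /= in_itv/=.
  rewrite ler_pdivrMl// ltr_pdivlMl// => uj.
  by have := floor_itv (2 ^+ q * u); rewrite uj intrD1 -pmulrn.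
rewrite ler_pdivrMl// ltr_pdivlMl// => uj.
by apply/floor_def; rewrite intrD1 -pmulrn.
Qed.

Lemma lebesgue_dyadic q j : leb (dyadic q j) = (2 ^- q)%:E.
Proof.
have q0 : 0 < 2 ^- q :> R by rewrite invr_gt0 exprn_gt0.
rewrite dyadicE lebesgue_measure_itv/= lte_fin ltr_pM2l// ltrDl ltr01.
by rewrite -EFinB -mulrBr addrAC subrr add0r mulr1.
Qed.

Lemma measurable_dyadic q j : measurable (dyadic q j).
Proof. by rewrite dyadicE; exact: measurable_itv. Qed.

Lemma floor_double (y : R) :
  Num.floor (2 * y) = 2 * Num.floor y \/ Num.floor (2 * y) = 2 * Num.floor y +
    1.
Proof.
have /andP[] := floor_itv y; rewrite intrD1; set z := Num.floor y => h1 h2.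
have e2 : (2 * z)%:~R = 2 * z%:~R :> R by rewrite intrM.
have [h|h] := ltP (2 * y) (2 * z%:~R + 1); [left|right]; apply/floor_def.
  by rewrite intrD1 e2 h andbT; lra.
by rewrite !intrD1 e2 h /=; lra.
Qed.

Lemma odd_absz_double (z : int) :
  odd `|(2 * z)%R|%N = false /\ odd `|(2 * z + 1)%R|%N = true.
Proof. lia. Qed.

(** Fixing digit [q] selects a half of a dyadic interval of level [q]: the right half here, the left
    half for the complement in [dyadic_digitN]. *)
Lemma dyadic_digit q j : dyadic q j `&` [set u | digit q u] = dyadic q.+1
  j.*2.+1.
Proof.
apply/seteqP; split => u; rewrite /dyadic /digit /= exprS -mulrA;
  have [odd0 odd1] := odd_absz_double (Num.floor (2 ^+ q * u));
  case: (floor_double (2 ^+ q * u)) => ->; rewrite ?odd0 ?odd1;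
  move: (Num.floor (2 ^+ q * u)) => z {odd0 odd1}.
- by case.
- by case=> + _; lia.
- by lia.
- by move=> h; split => //; lia.
Qed.

Lemma dyadic_digitN q j : dyadic q j `&` ~` [set u | digit q u] = dyadic q.+1
  j.*2.
Proof.
apply/seteqP; split => u; rewrite /dyadic /digit /= exprS -mulrA;
  have [odd0 odd1] := odd_absz_double (Num.floor (2 ^+ q * u));
  case: (floor_double (2 ^+ q * u)) => ->; rewrite ?odd0 ?odd1;
  move: (Num.floor (2 ^+ q * u)) => z {odd0 odd1}.
- by case=> + _; lia.
- by case.
- by move=> h; split => //; lia.
- by lia.
Qed.

(** Induction on the number of digits, with [q] and [j] free so that the hypothesis applies to both
    halves of [dyadic q j]. Measurability is carried along for the additivity step. *)
Lemma lebesgue_digits (m : nat) (F : pred nat) (q j : nat) :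
  let D := dyadic q j `&` [set u | forall k, (k < m)%N -> F k -> digit (q + k)
    u] in
  measurable D /\
  leb D = (2 ^- q * \prod_(k < m) (if F k then 2^-1 else 1))%:E.
Proof.
elim: m F q j => [|m IH] F q j /=.
  have -> : [set u | forall k, (k < 0)%N -> F k -> digit (q + k) u] = setT.
    by apply/seteqP; split.
  by rewrite setIT big_ord0 mulr1 lebesgue_dyadic; split => //;
    exact: measurable_dyadic.
pose E : set (measurableTypeR R) :=
  [set u | forall k, (k < m)%N -> F k.+1 -> digit (q.+1 + k) u].
pose G : set (measurableTypeR R) := [set u | F 0%N -> digit q u].
have split_digits :
    [set u | forall k, (k < m.+1)%N -> F k -> digit (q + k) u] = G `&` E.
  apply/seteqP; split => [u h|u [h1 h2] [_|k km]]; last 2 first.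
  - by rewrite addn0.
  - by rewrite -addSnnS; exact: h2.
  split => /= [F0|k km Fk]; first by rewrite -[q]addn0; exact: h.
  by rewrite addSnnS; exact: h.
have [m1 l1] := IH (fun k => F k.+1) q.+1 j.*2.+1.
have [m0 l0] := IH (fun k => F k.+1) q.+1 j.*2.
rewrite -dyadic_digit -/E in m1 l1; rewrite -dyadic_digitN -/E in m0 l0.
rewrite big_ord_recl/= split_digits setIA.
set p := \prod_(_ < _) _ in l1 l0 *.
case: ifPn => F0.
  have -> : G = [set u | digit q u].
    by apply/seteqP; split => [u|u] /=; [exact|move=> ? _].
  by rewrite l1; split => //; congr EFin;
    rewrite exprS invfM mulrA [2^-1 * _]mulrC.
have -> : G = setT.
  by apply/seteqP; split => u //= _; rewrite /G/= (negbTE F0).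
(* When digit [q] is unconstrained, both halves contribute the same amount, which restores the
   factor 2 lost in passing to level [q + 1]. *)
have -> : dyadic q j `&` setT `&` E =
    (dyadic q j `&` [set u | digit q u] `&` E) `|`
    (dyadic q j `&` ~` [set u | digit q u] `&` E).
  by rewrite -setIUl -setIUr setUv.
split; first exact: measurableU.
transitivity (leb (dyadic q j `&` [set u | digit q u] `&` E) +
              leb (dyadic q j `&` ~` [set u | digit q u] `&` E))%E.
  by apply: measureU => //; rewrite -subset0 => u [[[_ ?] _] [[_ ?] _]].
rewrite l1 l0 -EFinD; congr EFin.
by rewrite mul1r exprS invfM; field; rewrite expf_neq0.
Qed.

End coin_tossing.

(** * The fair coin measure *)

Section uniform_measure.
Context {R : realType}.
Local Notation leb := (@lebesgue_measure R).
Local Notation RT := (measurableTypeR R).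

Definition unif : set RT -> \bar R :=
  mrestr leb (measurable_itv `[0 : R, 1 : R[).

HB.instance Definition _ := Measure.on unif.

Let unif_setT : unif setT = 1%E.
Proof.
by rewrite /unif /mrestr setTI lebesgue_measure_itv/= lte_fin ltr01 oppr0 adde0.
Qed.

HB.instance Definition _ := Measure_isProbability.Build _ _ R unif unif_setT.

Lemma measurable_addrr (c : R) : measurable_fun setT ((fun x => x + c) : RT ->
  RT).
Proof. by apply: measurable_funD. Qed.

(** The image of Lebesgue measure under a translation has the right value on half-open intervals,
    and these determine the measure. *)
Lemma lebesgue_measureD (c : R) (A : set RT) : measurable A ->
  leb ((fun x => x + c) @^-1` A) = leb A.
Proof.
move=> mA.
pose phi : {mfun RT >-> RT} :=
  HB.pack (fun x : RT => x + c : RT) (isMeasurableFun.Build _ _ _ _ _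
    (measurable_addrr c)).
apply/esym; apply: (@lebesgue_measure_unique R (pushforward leb phi)) => //= _
  [[a b]] _ <-.
rewrite /pushforward.
have -> : phi @^-1` `]a, b] = `]a - c, b - c]%classic :> set R.
  by apply/seteqP; split => x /=; rewrite !in_itv/= ltrBlDr lerBrDr.
by rewrite !lebesgue_measure_itv/= !lte_fin ltrD2r -!EFinB opprB addrA subrK.
Qed.

Definition rotate (t s : R) : R := s + t - (Num.floor (s + t))%:~R.

(** A rotation of the circle is an exchange of two intervals: with [c] the fractional part of [t],
    it moves [[0, 1 - c)] by [c] and [[1 - c, 1)] by [c - 1]. *)
Lemma unif_rotate (t : R) (A : set RT) : measurable A ->
  unif (rotate t @^-1` A) = unif A.
Proof.
move=> mA; pose c := t - (Num.floor t)%:~R.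
have /andP[c0 c1] : 0 <= c < 1.
  have /andP[h1 h2] := floor_itv t; rewrite intrD1 in h2.
  by rewrite /c subr_ge0 h1 ltrBlDl.
have rot s : 0 <= s < 1 -> rotate t s = if s + c < 1 then s + c else s + (c -
  1).
  move=> /andP[s0 s1]; rewrite /rotate.
  have -> : s + t = s + c + (Num.floor t)%:~R by rewrite /c; lra.
  rewrite floorDrz ?intr_int// intrKfloor intrD.
  case: ltP => h.
    have -> : Num.floor (s + c) = 0 by apply: floor_def; rewrite intrD1; lra.
    by lra.
  have -> : Num.floor (s + c) = 1 by apply: floor_def; rewrite intrD1; lra.
  by lra.
(* The parts of [A] in the images of the two exchanged intervals. *)
pose A1 := A `&` `[c, 1[%classic; pose A0 := A `&` `[0, c[%classic.
have mA1 : measurable A1 by apply: measurableI => //; exact: measurable_itv.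
have mA0 : measurable A0 by apply: measurableI => //; exact: measurable_itv.
rewrite /unif /mrestr.
have -> : rotate t @^-1` A `&` `[0, 1[ =
    ((fun x => x + c) @^-1` A1) `|` ((fun x => x + (c - 1)) @^-1` A0).
  apply/seteqP; split => s; rewrite /A1 /A0 /= ?in_itv/=.
    case=> + s01; rewrite rot//; case: ltP => h As; [left|right];
    by split => //; lra.
  case=> -[As /andP[h1 h2]].
    have s01 : 0 <= s < 1 by lra.
    by rewrite rot// h2.
  have s01 : 0 <= s < 1 by lra.
  by rewrite rot// ifF//; apply/negbTE; rewrite -leNgt; lra.
have -> : A `&` `[0, 1[ = A1 `|` A0.
  rewrite /A1 /A0 -setIUr; congr (_ `&` _); apply/seteqP; split => s /=;
  rewrite !in_itv/=; last by case; lra.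
  by case: (ltP s c) => ? ?; [right|left]; lra.
have mshift c' B : measurable B -> measurable ((fun x : RT => x + c' : RT)
  @^-1` B).
  by move=> mB; rewrite -[X in measurable X]setTI; exact: measurable_addrr.
transitivity (leb ((fun x => (x + c)%R) @^-1` A1) +
              leb ((fun x => (x + (c - 1))%R) @^-1` A0))%E.
  apply: measureU; [exact: mshift|exact: mshift|].
  by rewrite -subset0 => s [[_ +] [_ +]]; rewrite /= !in_itv/= => ? ?; lra.
transitivity (leb A1 + leb A0)%E.
  by congr (_ + _)%E; exact: lebesgue_measureD.
apply/esym/measureU => //.
by rewrite -subset0 => s [[_ +] [_ +]]; rewrite /= !in_itv/= => ? ?; lra.
Qed.

Lemma measurable_floor_fun d (T : measurableType d) (f : T -> RT) :
  measurable_fun setT f ->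
  measurable_fun setT (fun w => (Num.floor (f w : R))%:~R : RT).
Proof.
move=> mf _ Y mY; rewrite setTI.
have -> : (fun w => (Num.floor (f w : R))%:~R : RT) @^-1` Y =
    \bigcup_(z in [set z : int | Y (z%:~R : R)]) [set w | Num.floor (f w : R) =
      z].
  by apply/seteqP; split => [w Yw|w [z /= Yz wz]];
    [exists (Num.floor (f w : R))|rewrite /= wz].
by apply: countType_bigcup_measurable => z _; exact: measurable_floor_eq.
Qed.

End uniform_measure.

(** * Coin sequences: cylinders and the shift *)

Definition coin_events : set (set (int -> bool)) :=
  [set C | exists i, C = [set x : int -> bool | x i]].

Notation coin_space := (g_sigma_algebraType coin_events).

(* These cylinders already form a generating pi-system, so that the coin
   measure is determined by their measures 2^-#F. *)
Definition all_ones (F : {fset int}) : set coin_space :=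
  [set x | forall i, i \in F -> x i].

Definition shift (k : int) (x : coin_space) : coin_space := fun i => x (i - k).

Lemma measurable_coord (i : int) : measurable [set x : coin_space | x i].
Proof. by apply: sub_sigma_algebra; exists i. Qed.

Lemma measurable_sequence d (T : measurableType d) (i : int) :
  measurable [set p : T * coin_space | p.2 i].
Proof.
have := @measurable_snd _ _ T coin_space measurableT _ (measurable_coord i).
by rewrite setTI.
Qed.

Lemma measurable_to_coin_space d (T : measurableType d) (f : T -> coin_space) :
  (forall i, measurable [set w | f w i]) -> measurable_fun setT f.
Proof.
move=> mf; apply: (@measurability _ _ T coin_space setT f coin_events) => //.
by move=> _ [_ [i ->] <-]; rewrite setTI; exact: mf.
Qed.

Lemma measurable_shift k : measurable_fun setT (shift k).
Proof. by apply: measurable_to_coin_space => i; exact: measurable_coord. Qed.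

Lemma all_onesI (F G : {fset int}) : all_ones F `&` all_ones G = all_ones (F
  `|` G)%fset.
Proof.
apply/seteqP; split => [x [xF xG] i|x xFG].
  by rewrite in_fsetU => /orP[/xF|/xG].
by split => i iF; apply: xFG; rewrite in_fsetU iF ?orbT.
Qed.

Lemma measurable_all_ones F : measurable (all_ones F).
Proof.
have -> : all_ones F = \bigcap_(i in [set` F]) [set x : coin_space | x i].
  by apply/seteqP; split => x.
by apply: fin_bigcap_measurable => [|i _];
  [exact: finite_fset|exact: measurable_coord].
Qed.

Lemma all_ones_setI_closed : setI_closed (range all_ones).
Proof. by move=> _ _ [F _ <-] [G _ <-]; exists (F `|` G)%fset;
  rewrite ?all_onesI. Qed.

Lemma measurable_coin_spaceE : @measurable _ coin_space = <<s range all_ones >>.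
Proof.
apply/seteqP; split; apply: smallest_sub; try exact: smallest_sigma_algebra.
  move=> _ [i ->]; apply: sub_sigma_algebra; exists [fset i]%fset => //.
  apply/seteqP; split => [x|x xi j]; last by rewrite in_fset1 => /eqP ->.
  by apply; rewrite in_fset1.
by move=> _ [F _ <-]; exact: measurable_all_ones.
Qed.

Lemma shift_all_ones k F :
  shift k @^-1` all_ones F = all_ones [fset i - k | i in F]%fset.
Proof.
apply/seteqP; split => [x xF _ /imfsetP[i /= iF ->]|x xF i iF]; first exact: xF.
by apply: xF; apply/imfsetP; exists i.
Qed.

Lemma card_fset_shift (k : int) F : #|` [fset i - k | i in F]%fset| = #|` F|.
Proof. by rewrite card_imfset//; exact: addIr. Qed.

Section coin_measure.
Context {R : realType}.

(** The injective code [pickle] makes distinct integers read distinct binary digits. *)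
Definition toss (u : measurableTypeR R) : coin_space := fun i => digit
  (choice.pickle i) u.

Let measurable_toss : measurable_fun setT toss.
Proof. by apply: measurable_to_coin_space => i; exact: measurable_digit. Qed.

HB.instance Definition _ := isMeasurableFun.Build _ _ _ _ toss measurable_toss.

Definition coin : probability coin_space R :=
  distribution (@unif R) (toss : {RV (@unif R) >-> coin_space}).

Lemma coin_all_ones F : coin (all_ones F) = (2^-1 ^+ #|` F|)%:E.
Proof.
(* The digit positions read by [F], and below a number [m] exceeding all of them. *)
pose s := map choice.pickle (enum_fset F).
pose m := (\max_(k <- s) k).+1.
have sm k : k \in s -> (k < m)%N by move=> ks; rewrite ltnS;
  exact: leq_bigmax_seq.
(* [dyadic 0 0] is [[0, 1)], so intersecting with it is the restriction that defines [unif]. *)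
have [_] := @lebesgue_digits R m (mem s) 0 0.
rewrite expr0 invr1 mul1r; set D := [set u | _].
have -> : \prod_(k < m) (if mem s k then 2^-1 else 1) = 2^-1 ^+ #|` F| :> R.
  rewrite -(big_mkord xpredT (fun k => if mem s k then 2^-1 else 1))
    -big_mkcond/=.
  rewrite big_const_seq iter_mulr_1 -[count _ _]size_filter; congr (_ ^+ _).
  have -> : #|` F| = size s by rewrite size_map.
  apply/perm_size/uniq_perm.
  - by rewrite filter_uniq// iota_uniq.
  - by rewrite map_inj_uniq ?fset_uniq//; exact: pcan_inj choice.pickleK.
  - move=> k; rewrite mem_filter mem_index_iota/=.
    by apply/andP/idP => [[]//|ks]; split => //; exact: sm.
move=> <-; rewrite /coin /distribution /pushforward /unif/= /mrestr.
congr (lebesgue_measure _); rewrite setIC; congr (_ `&` _).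
  by rewrite dyadicE expr0 invr1 !mul1r add0r.
apply/seteqP; split => [u uF k km /mapP[i iF ->]|u uF i iF]; first exact: uF.
by apply: (uF (choice.pickle i)); [apply: sm|]; exact: map_f.
Qed.

(** Shifting a cylinder keeps the number of prescribed coordinates, so both measures agree on the
    generating pi-system. *)
Lemma coin_shift k A : measurable A -> coin (shift k @^-1` A) = coin A.
Proof.
move=> mA.
pose phi : {RV coin >-> coin_space} :=
  HB.pack (shift k) (isMeasurableFun.Build _ _ _ _ _ (measurable_shift k)).
apply: (measure_unique (range all_ones) (fun=> setT) measurable_coin_spaceE
  all_ones_setI_closed _ _ (distribution coin phi) coin) => //.
- by move=> _; exists fset0 => //; apply/seteqP; split.
- by rewrite bigcup_const.
- move=> _ [F _ <-]; transitivity ((2^-1 ^+ #|` F|)%:E : \bar R);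
  last exact/esym/coin_all_ones.
  by rewrite -(card_fset_shift k) -coin_all_ones -shift_all_ones.

- by move=> _; rewrite ltey_eq fin_num_measure.
Qed.

End coin_measure.

(** * Sums of pairwise independent indicators *)

Section indicator_variance.
Context d (T : measurableType d) (R : realType) (P : probability T R).
Implicit Types A B : set T.

Lemma Lfun2_ae_bounded (f : T -> R) (M : R) : measurable_fun setT f ->
  {ae P, forall x, `|f x| <= M} -> f \in Lfun P 2%:E.
Proof.
move=> mf fM; apply/andP; split; rewrite inE//=.
rewrite /finite_norm unlock /Lnorm/=.
(* The majorant uses [|M|] because the sign of [M] is not prescribed. *)
apply: poweR_lty; apply: (@le_lt_trans _ _ (\int[P]_x (`|M| `^ 2)%:E)%E).
  apply: ae_ge0_le_integral; first exact: measurableT.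
  - by move=> x _; rewrite lee_fin powR_ge0.
  - apply/measurable_EFinP; apply: (measurableT_comp (measurable_powR 2)).
    exact: measurableT_comp.
  - by move=> x _; rewrite lee_fin powR_ge0.
  - exact: measurable_cst.
  - apply: filterS fM => x fxM _; rewrite lee_fin ge0_ler_powR// ?nnegrE//.
    by rewrite (le_trans fxM)// ler_norm.
rewrite integral_cst//.
apply: lte_mul_pinfty => //.
by rewrite ltey_eq fin_num_measure.
Qed.

Lemma Lfun2_indic A : measurable A -> (\1_A : T -> R) \in Lfun P 2%:E.
Proof.
move=> mA; apply: (@Lfun2_ae_bounded _ 1); first exact: measurable_indic.
by apply: aeW => x; rewrite indicE normr_nat lern1 leq_b1.
Qed.

Lemma covariance_indic A B : measurable A -> measurable B ->
  covariance P \1_A \1_B = (P (A `&` B) - P A * P B)%E.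
Proof.
move=> mA mB.
have Pfin : P setT \is a fin_num := fin_num_measure P _ measurableT.
have AB : (\1_A * \1_B : T -> R) = \1_(A `&` B) by rewrite indicI.
rewrite covarianceE ?AB ?Lfun_subset12 ?Lfun2_indic//; last exact: measurableI.
by rewrite !expectation_indic//; exact: measurableI.
Qed.

Lemma Lfun2_sum_indic (I : Type) (s : seq I) (B : I -> set T) :
  (forall i, measurable (B i)) -> (\sum_(i <- s) \1_(B i) : T -> R) \in Lfun P
    2%:E.
Proof.
move=> mB; apply: rpred_sum => [|? i _]; [by rewrite lee1n|exact: Lfun2_indic].
Qed.

Lemma covariance_sum_indic (I : Type) (s : seq I) (B : I -> set T) A :
  (forall i, measurable (B i)) -> measurable A ->
  covariance P \1_A (\sum_(i <- s) \1_(B i)) =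
  (\sum_(i <- s) covariance P \1_A \1_(B i))%E.
Proof.
move=> mB mA; elim: s => [|i s IH]; first by rewrite !big_nil covariance_cst_r.
rewrite !big_cons -IH [LHS]covarianceDr//.
- exact: Lfun2_indic.
- exact: Lfun2_indic.
- exact: Lfun2_sum_indic.
Qed.

(** Pairwise independence kills every cross covariance, so the variances add up. *)
Lemma variance_sum_indic (I : eqType) (s : seq I) (B : I -> set T) :
  (forall i, measurable (B i)) -> uniq s ->
  (forall i j, i != j -> P (B i `&` B j) = (P (B i) * P (B j))%E) ->
  variance P (\sum_(i <- s) \1_(B i)) = (\sum_(i <- s) (P (B i) - P (B i) ^+
    2))%E.
Proof.
move=> mB us indep; elim: s us => [_|i s IH /= /andP[si us]].
  by rewrite !big_nil variance_cst.
rewrite !big_cons -IH// [LHS]varianceD ?Lfun2_indic ?Lfun2_sum_indic//.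
have -> : covariance P \1_(B i) (\sum_(j <- s) \1_(B j)) = 0%E.
  rewrite covariance_sum_indic// big_seq big1// => j js.
  rewrite covariance_indic// indep ?subee ?fin_numM ?fin_num_measure//.
  by apply: contraNneq si => ->.
by rewrite mule0 adde0 {1}/variance covariance_indic// setIid.
Qed.

(** Cauchy-Schwarz in two-sided form: the one-sided bound is applied to [X] and to [- X]. *)
Lemma covariance_sqr_le (X Y : T -> R) : X \in Lfun P 2%:E -> Y \in Lfun P 2%:E
  ->
  fine (covariance P X Y) ^+ 2 <= fine (variance P X) * fine (variance P Y).
Proof.
move=> X2 Y2.
have Pfin : P setT \is a fin_num := fin_num_measure P _ measurableT.
have X1 := Lfun_subset12 Pfin X2.
have Y1 := Lfun_subset12 Pfin Y2.
have XY1 := Lfun2_mul_Lfun1 X2 Y2.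
have VX0 : 0 <= fine (variance P X) by rewrite fine_ge0// variance_ge0.
have VY0 : 0 <= fine (variance P Y) by rewrite fine_ge0// variance_ge0.
have cov_le Z : Z \in Lfun P 2%:E -> variance P Z = variance P X ->
    covariance P Z Y \is a fin_num ->
    fine (covariance P Z Y) <=
      Num.sqrt (fine (variance P X)) * Num.sqrt (fine (variance P Y)).
  move=> Z2 VZ fZ; rewrite -lee_fin fineK// (le_trans (covariance_le Z2 Y2))//
    VZ.
  by rewrite -(fineK (variance_fin_num X2)) -(fineK (variance_fin_num Y2))
    EFinM.
have fXY := covariance_fin_num X1 Y1 XY1.
have h1 := cov_le X X2 erefl fXY.
have NX2 : (\- X)%R \in Lfun P 2%:E by rewrite rpredN.
have h2 := cov_le _ NX2 (varianceN X2).
rewrite covarianceNl// fin_numN fXY fineN lerNl in h2; have {}h2 := h2 isT.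
rewrite -(sqr_sqrtr VX0) -(sqr_sqrtr VY0) -exprMn -real_normK ?num_real//.
rewrite ler_sqr ?nnegrE ?normr_ge0 ?mulr_ge0 ?sqrtr_ge0//.
by rewrite ler_norml h1 h2.
Qed.

End indicator_variance.

(** * Ergodicity of the Bernoulli shift *)

Section coin_ergodicity.
Context {R : realType}.
Local Notation coin := (@coin R).

Lemma all_ones_indep F G : [disjoint F & G]%fset ->
  coin (all_ones F `&` all_ones G) = (coin (all_ones F) * coin (all_ones G))%E.
Proof.
move=> FG; rewrite all_onesI !coin_all_ones -EFinM -exprD.
by rewrite cardfsU (disjoint_fsetI0 FG) cardfs0 subn0.
Qed.

Lemma fset_shift_disjoint (F : {fset int}) : exists K : nat,
  forall i j : nat, i != j ->
  [disjoint [fset k - (K * i)%N%:Z | k in F] & [fset k - (K * j)%N%:Z | k in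
    F]]%fset.
Proof.
pose M := \max_(k <- enum_fset F) `|k|%N.
have leM k : k \in F -> (`|k| <= M)%N by move=> kF;
  exact: (@leq_bigmax_seq _ _ _ (fun k : int => `|k|%N)).
(* Two elements of [F] differ by at most [2M], so translates by distinct multiples of [2M + 1]
   cannot meet. *)
exists (M.*2.+1) => i j ij; apply/fdisjointP => _ /imfsetP[k /= /leM kM ->].
apply/negP => /imfsetP[l /= /leM lM]; move: ij kM lM.
wlog : i j k l / (i < j)%N => [wl ij kM lM e|ij _ kM lM e].
  have [h|h|h] := ltngtP i j; [exact: (wl i j k l)| |by rewrite h eqxx in ij].
  by apply: (wl j i l k) => //; rewrite eq_sym.
have h : (M.*2.+1 * i + M.*2.+1 <= M.*2.+1 * j)%N by rewrite -mulnSr leq_mul2l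
  ij orbT.
move: h e; set a := (_ * i)%N; set b := (_ * j)%N; lia.
Qed.

Lemma invariant_indep_all_ones (A : set coin_space) F : measurable A ->
  (forall k : nat, shift k%:Z @^-1` A = A) ->
  coin (A `&` all_ones F) = (coin A * coin (all_ones F))%E.
Proof.
move=> mA invA; have [K disjK] := fset_shift_disjoint F.
pose B (n : nat) : set coin_space := shift (K * n)%N%:Z @^-1` all_ones F.
have mB n : measurable (B n).
  by rewrite /B shift_all_ones; exact: measurable_all_ones.
have BE n : coin (B n) = coin (all_ones F).
  by apply: coin_shift; exact: measurable_all_ones.
have ABE n : coin (A `&` B n) = coin (A `&` all_ones F).
  rewrite -(coin_shift (K * n)%N%:Z (measurableI _ _ mA (measurable_all_ones
    F))).
  by rewrite preimage_setI invA.
have mF := measurable_all_ones F.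
pose a := fine (coin A); pose p := fine (coin (all_ones F)).
pose q := fine (coin (A `&` all_ones F)).
have aE : coin A = a%:E by rewrite fineK// fin_num_measure.
have pE : coin (all_ones F) = p%:E by rewrite fineK// fin_num_measure.
have qE : coin (A `&` all_ones F) = q%:E.
  by rewrite fineK// fin_num_measure//; exact: measurableI.
have a01 : 0 <= a <= 1 by rewrite -!lee_fin -aE measure_ge0 probability_le1.
have p01 : 0 <= p <= 1 by rewrite -!lee_fin -pE measure_ge0 probability_le1.
have var01 (x : R) : 0 <= x <= 1 -> 0 <= x - x * x /\ x - x * x <= 1.
  by clear => /andP[x0 x1]; split; nra.
(* Cauchy-Schwarz for [A] and the sum of the first [N] indicators: the covariance is [N (q - a p)],
   and the two variances are at most 1 and [N]. One factor [N] is then cancelled. *)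
have bound (N : nat) : N%:R * (q - a * p) ^+ 2 <= 1.
  have [->|N0] := eqVneq N 0%N; first by rewrite mul0r.
  have := @covariance_sqr_le _ _ _ coin \1_A (\sum_(n <- iota 0 N) \1_(B n))
    (Lfun2_indic _ mA) (Lfun2_sum_indic _ _ mB).
  rewrite variance_sum_indic ?iota_uniq//; last first.
    move=> i j ij; rewrite /B !shift_all_ones all_ones_indep//.
    exact: disjK.
  rewrite covariance_sum_indic// {1}/variance covariance_indic// setIid.
  rewrite (eq_bigr (fun=> (q - a * p)%:E)); last first.
    by move=> n _; rewrite covariance_indic// ABE BE qE aE pE -EFinM -EFinB.
  rewrite [X in _ <= _ * fine X](eq_bigr (fun=> (p - p ^+ 2)%:E)); last first.
    by move=> n _; rewrite BE pE.
  rewrite !sumEFin !big_const_seq !count_predT size_iota !iter_addr_0 aE -EFinM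
    -EFinB/=.
  rewrite -[X in X ^+ 2 <= _]mulr_natl -[X in _ <= _ * X]mulr_natl exprMn => h.
  rewrite -(@ler_pM2l R N%:R) ?ltr0n ?lt0n// mulr1 mulrA -expr2.
  apply: (le_trans h); rewrite mulrCA ler_piMr//.
  have [? ?] := var01 _ a01; have [? ?] := var01 _ p01.
  by rewrite mulr_ile1// expr2.
rewrite qE aE pE -EFinM; congr EFin; apply/eqP; rewrite -subr_eq0 -sqrf_eq0.
apply/negPn/negP => d0; have {}d0 : 0 < (q - a * p) ^+ 2.
  by rewrite lt_neqAle eq_sym d0 sqr_ge0.
(* An [N] larger than the inverse of the squared covariance contradicts the bound. *)
have := bound (Num.truncn ((q - a * p) ^+ 2)^-1).+1.
rewrite leNgt -ltr_pdivrMr// mul1r => /negP; apply.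
exact: truncnS_gt.
Qed.

Lemma coin_ergodic (A : set coin_space) : measurable A ->
  (forall k : nat, shift k%:Z @^-1` A = A) -> coin A = 0%E \/ coin A = 1%E.
Proof.
move=> mA invA.
have a0 : 0 <= fine (coin A) by rewrite fine_ge0.
have aE : coin A = (fine (coin A))%:E by rewrite fineK// fin_num_measure.
(* Independence of [A] from the cylinders extends to all events by uniqueness of measures. Taking
   [S = A] then gives [c = c * c]. *)
have indep S : measurable S -> mrestr coin mA S = mscale (NngNum a0) coin S.
  apply: (measure_unique (range all_ones) (fun=> setT) measurable_coin_spaceE
    all_ones_setI_closed).
  - by move=> _; exists fset0 => //; apply/seteqP; split.
  - by rewrite bigcup_const.
  - move=> _ [F _ <-]; have := invariant_indep_all_ones F mA invA.
    by rewrite setIC => h; apply: (etrans h); congr (_ * _)%E.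
  - move=> _; have : (coin (setT `&` A) < +oo)%E.
      by rewrite setTI ltey_eq fin_num_measure.
    exact.
have : coin A = ((fine (coin A))%:E * coin A)%E.
  by rewrite -{1}[A]setIid; exact: indep A mA.
move: aE; set c := fine (coin A) => aE; rewrite aE -EFinM => -[] /eqP.
rewrite -subr_eq0 -{1}[c]mulr1 -mulrBr mulf_eq0 => /orP[/eqP ->|];
  first by left.
by rewrite subr_eq0 => /eqP <-; right.
Qed.

End coin_ergodicity.

(** * The suspension flow *)

Section suspension.
Context {R : realType}.
Local Notation RT := (measurableTypeR R).
Local Notation space := (RT * coin_space)%type.

(* Flowing by t moves the first coordinate by t / 2 and winds it back to its
   unit interval [k, k + 1). Keeping track of that interval extends the
   suspension from [0, 1) to all of R; the measure only charges [0, 1). *)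
Definition winding (t : R) (w : space) : int :=
  Num.floor (w.1 + t / 2 : R) - Num.floor (w.1 : R).

Definition flow (t : R) (w : space) : space :=
  (w.1 + t / 2 - (winding t w)%:~R, shift (winding t w) w.2).

Definition susp : set space -> \bar R := (@unif R \x @coin R)%E.

HB.instance Definition _ := Measure.on susp.

Let susp_setT : susp setT = 1%E.
Proof.
rewrite -setXTT.
have -> : (1 = @unif R setT * @coin R setT)%E.
  have -> : @unif R setT = 1%E by exact: probability_setT.
  have -> : @coin R setT = 1%E by exact: probability_setT.
  by rewrite mule1.
exact: product_measure1E.
Qed.

HB.instance Definition _ := Measure_isProbability.Build _ _ R susp susp_setT.

Lemma flow0 w : flow 0 w = w.
Proof.
case: w => s x; rewrite /flow /winding/= mul0r addr0 subrr subr0.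
by congr pair; apply/funext => i; rewrite /shift subr0.
Qed.

Lemma flowD t u w : flow (t + u) w = flow t (flow u w).
Proof.
case: w => s x; rewrite /flow /winding/=.
set k := Num.floor (s + u / 2) - Num.floor s.
(* Subtracting the integer [k] lowers every floor by [k]; the winding numbers of successive flows
   therefore add up. *)
have fl z : Num.floor (s + u / 2 - k%:~R + z) = Num.floor (s + u / 2 + z) - k.
  by rewrite addrAC -intrN floorDrz ?intr_int// intrKfloor.
have e1 := fl (t / 2); have e2 := fl 0; rewrite !addr0 in e2.
have -> : s + (t + u) / 2 = s + u / 2 + t / 2 by lra.
rewrite e1 e2; congr pair; first by rewrite /k !intrD !intrN; lra.
by apply/funext => i; rewrite /shift; congr x; rewrite /k; lia.
Qed.

Lemma measurable_flow : measurable_fun setT (fun tw : RT * space => flow tw.1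
  tw.2).
Proof.
have ms : measurable_fun setT (fun tw : RT * space => tw.2.1).
  by apply: measurableT_comp => //; exact: measurable_fst.
have mt : measurable_fun setT (fun tw : RT * space => (tw.2.1 : R) + (tw.1 : R)
  / 2).
  apply: measurable_funD => //; apply: measurable_funM => //.
have mx i : measurable [set tw : RT * space | tw.2.2 i].
  have : measurable_fun setT (fun tw : RT * space => tw.2.2).
    by apply: measurableT_comp => //; exact: measurable_snd.
  by move=> /(_ measurableT _ (measurable_coord i)); rewrite setTI.
apply: measurable_fun_pair => /=.
  apply: measurable_funB => //.
  apply: (@eq_measurable_fun _ _ _ _ _ (fun tw : RT * space =>
    (Num.floor ((tw.2.1 : R) + (tw.1 : R) / 2))%:~R - (Num.floor (tw.2.1 :
      R))%:~R : RT)).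
    by move=> tw _; rewrite /winding intrB.
  by apply: measurable_funB; exact: measurable_floor_fun.
apply: measurable_to_coin_space => i.
(* The coordinate that is read depends on two floors only; their values cut the space into countably
   many pieces, on each of which it is fixed. *)
have -> : [set tw : RT * space | shift (winding tw.1 tw.2) tw.2.2 i] =
    \bigcup_(z in [set: int * int])
      ([set tw : RT * space | Num.floor (tw.2.1 + tw.1 / 2 : R) = z.1] `&`
       [set tw : RT * space | Num.floor (tw.2.1 : R) = z.2] `&`
       [set tw : RT * space | tw.2.2 (i - (z.1 - z.2))]).
  apply/seteqP; split => [tw h|tw [z _ [[/= h1 h2] h3]]].
    by exists (Num.floor (tw.2.1 + tw.1 / 2 : R), Num.floor (tw.2.1 : R)).
  by rewrite /shift /winding /= h1 h2.
apply: countType_bigcup_measurable => z _; apply: measurableI => //.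
by apply: measurableI; exact: measurable_floor_eq.
Qed.

Lemma measurable_flow1 t : measurable_fun setT (flow t).
Proof.
pose slice (w : space) : RT * space := (t, w).
have mslice : measurable_fun setT slice by apply: measurable_fun_pair.
exact: (measurableT_comp measurable_flow mslice).
Qed.

Lemma floor_unit (s : R) : 0 <= s < 1 -> Num.floor s = 0.
Proof. by move=> s01; apply: floor_def; rewrite mulr0z intrD1 mulr0z add0r. Qed.

Lemma ae_unif (Q : RT -> Prop) : (forall s : R, 0 <= s < 1 -> Q s) ->
  {ae @unif R, forall s, Q s}.
Proof.
move=> Q01.
exists (~` `[0 : R, 1 : R[%classic); split.
- by apply: measurableC; exact: measurable_itv.
- by rewrite /unif /mrestr setICl measure0.
- by move=> s /= nQ; rewrite in_itv/= => /Q01.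
Qed.

Lemma measurable_rotate t : measurable_fun setT (rotate t : RT -> RT).
Proof.
apply: measurable_funB; first exact: measurable_addrr.
by apply: measurable_floor_fun; exact: measurable_addrr.
Qed.

(** By Fubini. For [s] in [[0, 1)] the section at [s] of the preimage is a shifted copy of the
    section of [A] at the rotated point; the shift preserves [coin] and the rotation preserves
    [unif]. *)
Lemma susp_flow t (A : set space) : measurable A -> susp (flow t @^-1` A) =
  susp A.
Proof.
move=> mA; rewrite /susp /product_measure1.
have mg := measurable_fun_xsection (@coin R) mA.
pose phi : {mfun RT >-> RT} :=
  HB.pack (rotate (t / 2) : RT -> RT) (isMeasurableFun.Build _ _ _ _ _
    (measurable_rotate (t / 2))).
transitivity (\int[@unif R]_s ((@coin R \o xsection A) \o phi) s)%E.
  apply: ge0_ae_eq_integral => //.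
  - apply: measurable_fun_xsection.
    by rewrite -[X in measurable X]setTI; exact: measurable_flow1.
  - exact: measurableT_comp.
  - apply: ae_unif => s s01 _.
    have fs : Num.floor (s : R) = 0 by exact: floor_unit.
    transitivity (@coin R (shift (Num.floor (s + t / 2 : R)) @^-1`
      xsection A (rotate (t / 2) s : RT))).
      congr (@coin R _); apply/seteqP.
      by split => x; rewrite /xsection/= !inE /flow /winding/= fs subr0.
    by apply: coin_shift; exact: measurable_xsection.
rewrite -(@ge0_integral_pushforward _ _ _ _ _ phi _ (@unif R) setT (@coin R \o
  xsection A))//.
by apply: eq_measure_integral => B mB _; exact: unif_rotate.
Qed.

(** Flows back to the base of the suspension; the factor 2 undoes the speed 1/2 of the first
    coordinate. *)
Lemma flow_base (s : R) (x : coin_space) :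
  0 <= s < 1 -> flow (- s * 2) (s, x) = (0 : R, x).
Proof.
move=> s01; rewrite /flow /winding /=; have -> : s + - s * 2 / 2 = 0 by lra.
rewrite floor0 floor_unit// subrr subr0; congr pair.
by apply/funext => i; rewrite /shift subr0.
Qed.

(** The return time to the base is 2, and the return map is the shift. *)
Lemma flow_nat (k : nat) (x : coin_space) :
  flow (k%:R * 2) (0 : R, x) = (0 : R, shift k%:Z x).
Proof.
rewrite /flow /winding /=; have -> : 0 + k%:R * 2 / 2 = k%:R :> R by lra.
by rewrite floor0 subr0 -[k%:R]/(k%:Z%:~R) intrKfloor subrr.
Qed.

(** The sections of an invariant set over [[0, 1)] all coincide with its section at 0, which is
    shift-invariant; ergodicity is thus inherited from the shift. *)
Lemma ergodic_flow (A : set space) : measurable A ->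
  (forall t, flow t @^-1` A = A) -> susp A = 0%E \/ susp A = 1%E.
Proof.
move=> mA invA; have mA0 := measurable_xsection (0%R : RT) mA.
have inA t w : A (flow t w) <-> A w by rewrite -{2}(invA t).
have -> : susp A = @coin R (xsection A (0%R : RT)).
  rewrite /susp /product_measure1.
  transitivity (\int[@unif R]_s (@coin R (xsection A (0%R : RT))))%E;
    last first.
    rewrite integral_cst// -[RHS]mule1.
    by congr (_ * _)%E; exact: (probability_setT (@unif R)).
  apply: ge0_ae_eq_integral => //; first exact: measurable_fun_xsection.
  apply: ae_unif => s s01 _.
  congr (@coin R _); apply/seteqP; split => x; rewrite /xsection/= !inE;
  by rewrite -(flow_base x s01) inA.
apply: coin_ergodic => // k.
by apply/seteqP; split => x; rewrite /xsection/= !inE -flow_nat inA.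
Qed.

Lemma pmp_flow : pmp_action susp flow.
Proof.
split; [exact: flow0|exact: flowD|exact: measurable_flow|exact: susp_flow].
Qed.

End suspension.

(** * The phase space is standard Borel *)

Section polish_model.
Context {R : realType}.

Definition polish : Type := (R * (int -> bool))%type.

HB.instance Definition _ := gen_eqMixin polish.
HB.instance Definition _ := gen_choiceMixin polish.
HB.instance Definition _ := isPointed.Build polish ((0, fun=> false) : polish).

Definition weight (i : int) : R := (choice.pickle i).+1%:R^-1.

Lemma weight_gt0 i : 0 < weight i.
Proof. by rewrite invr_gt0 ltr0n. Qed.

Definition discrepancy (x y : int -> bool) : set R :=
  [set weight i * (x i != y i)%:R | i in [set: int]].

(** The weight of the first coordinate, in the order of the codes, at which [x] and [y] differ, and
    0 if there is none: a metric for the product topology. *)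
Definition seq_dist (x y : int -> bool) : R := sup (discrepancy x y).

Let discrepancy_neq0 x y : discrepancy x y !=set0.
Proof. by exists (weight 0 * (x 0 != y 0)%:R); exists 0. Qed.

Lemma seq_dist_le x y (M : R) :
  (forall i, weight i * (x i != y i)%:R <= M) -> seq_dist x y <= M.
Proof. by move=> h; apply: ge_sup => // _ [i _ <-]; exact: h. Qed.

Lemma le_seq_dist x y i : weight i * (x i != y i)%:R <= seq_dist x y.
Proof.
apply: (@ub_le_sup R (discrepancy x y)); last by exists i.
exists 1 => _ [j _ <-].
by rewrite mulr_ile1 ?invf_le1 ?ler1n ?lern1 ?leq_b1 ?ltr0n// ltW// weight_gt0.
Qed.

Lemma seq_dist_lt_weight x y i : seq_dist x y < weight i -> x i = y i.
Proof.
move=> h; apply/eqP; apply/negPn/negP => xy.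
by have := le_lt_trans (le_seq_dist x y i) h; rewrite xy mulr1 ltxx.
Qed.

Lemma seq_dist_agree x y (n : nat) :
  (forall i, (choice.pickle i < n)%N -> x i = y i) -> seq_dist x y <=
    n.+1%:R^-1.
Proof.
move=> xy; apply: seq_dist_le => i; have [/xy ->|ni] := ltnP (choice.pickle i)
  n.
  by rewrite eqxx mulr0 invr_ge0.
have := leq_b1 (x i != y i); case: (_ != _) => _;
  rewrite ?mulr0 ?invr_ge0 ?mulr1//.
by rewrite /weight lef_pV2 ?posrE ?ltr0n// ler_nat.
Qed.

Definition polish_dist (p q : polish) : R := `|p.1 - q.1| + seq_dist p.2 q.2.

Let seq_distxx x : seq_dist x x = 0.
Proof.
apply/eqP; rewrite eq_le; apply/andP; split.
  by apply: seq_dist_le => i; rewrite eqxx mulr0.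
by apply: (le_trans _ (le_seq_dist x x 0)); rewrite eqxx mulr0.
Qed.

Let seq_dist_ge0 x y : 0 <= seq_dist x y.
Proof. by apply: (le_trans _ (le_seq_dist x y 0));
  rewrite mulr_ge0// ltW// weight_gt0. Qed.

Let polish_distxx p : polish_dist p p = 0.
Proof. by rewrite /polish_dist subrr normr0 seq_distxx addr0. Qed.

Let polish_dist_eq0 p q : polish_dist p q = 0 -> p = q.
Proof.
move=> /eqP; rewrite /polish_dist paddr_eq0// normr_eq0 subr_eq0 => /andP[/eqP
  h1 /eqP h2].
case: p q h1 h2 => [s x] [t y] /= -> d0; congr pair; apply/funext => i.
by apply: seq_dist_lt_weight; rewrite d0 weight_gt0.
Qed.

Let polish_dist_sym p q : polish_dist p q = polish_dist q p.
Proof.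
rewrite /polish_dist distrC; congr (_ + sup _).
by apply/seteqP; split => _ [i _ <-]; exists i => //; rewrite eq_sym.
Qed.

Let polish_dist_triangle q p r : polish_dist p r <= polish_dist p q +
  polish_dist q r.
Proof.
rewrite /polish_dist addrACA lerD ?ler_distD//; apply: seq_dist_le => i.
apply: le_trans (lerD (le_seq_dist _ _ i) (le_seq_dist _ _ i)).
rewrite -mulrDr ler_pM2l ?weight_gt0// -natrD ler_nat.
by case: (p.2 i) (q.2 i) (r.2 i) => -[] [].
Qed.

HB.instance Definition _ := isMetric.Build R polish
  polish_distxx polish_dist_eq0 polish_dist_sym polish_dist_triangle.

Lemma ball_polishE (p q : polish) (e : R) : ball p e q <-> polish_dist p q < e.
Proof. by rewrite ballEmdist. Qed.

Lemma polish_ball_fst (p q : polish) (e : R) : ball p e q -> `|p.1 - q.1| < e.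
Proof. by move=> /ball_polishE; apply: le_lt_trans; rewrite lerDl. Qed.

Lemma polish_ball_snd (p q : polish) (e : R) : ball p e q -> seq_dist p.2 q.2 <
  e.
Proof. by move=> /ball_polishE; apply: le_lt_trans; rewrite lerDr. Qed.

Lemma inv_nat_lt (e : R) : 0 < e -> exists n : nat, n.+1%:R^-1 < e.
Proof.
move=> e0; exists (Num.truncn e^-1); rewrite invf_plt ?posrE//.
exact: truncnS_gt.
Qed.

Lemma polish_complete (F : set_system polish) : ProperFilter F -> cauchy F ->
  exists p : polish, F --> p.
Proof.
move=> FF /cauchy_ballP cF.
have cexF e : 0 < e -> exists p, F (ball p e).
  by move=> e0; have /nearP_dep/filter_ex[p ?] := cF e e0; exists p.
have [l Fl] : exists l : R, fst @ F --> l.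
  suff : cvg (fst @ F) by move=> h; exists (lim (fst @ F)).
  apply: cauchy_cvg; apply: cauchy_exP => e e0.
  have [p Fp] := cexF e e0; exists p.1.
  have : F (fst @^-1` ball p.1 e) by apply: filterS Fp => q /polish_ball_fst.
  exact.
(* A ball of radius [weight i] fixes coordinate [i], so each coordinate is constant on some member
   of [F]. *)
have /choice[x Fx] : forall i, exists b, F [set q | q.2 i = b].
  move=> i.
  have [p Fp] := cexF _ (weight_gt0 i); exists (p.2 i).
  by apply: filterS Fp => q /polish_ball_snd/seq_dist_lt_weight.
have Fxn n : F [set q | forall i, (choice.pickle i < n)%N -> q.2 i = x i].
  elim: n => [|n IH]; first by apply: filterS filterT.
  (* The number [n] may or may not be the code of an integer; if it is not, no new coordinate has to
     be controlled. *)
  have [[j jn]|nj] := pselect (exists i : int, choice.pickle i = n).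
    apply: filterS2 IH (Fx j) => q qn qj i;
      rewrite ltnS leq_eqVlt => /orP[/eqP e|/qn//].
    by have -> : i = j by apply: (pcan_inj choice.pickleK); rewrite e.
  apply: filterS IH => q qn i; rewrite ltnS leq_eqVlt => /orP[/eqP e|/qn//].
  by case: nj; exists i.
exists (l, x); apply/fcvg_ballP => e e0.
have e20 : 0 < e / 2 by rewrite divr_gt0.
have [n ne] := inv_nat_lt e20.
have Fe : F (fst @^-1` ball l (e / 2)).
  by apply: (@cvg_ball _ _ _ _ _ fst l Fl _ e20).
have /filterI/(_ Fe) := Fxn n; apply: filterS => q [qn ql]; apply/ball_polishE.
rewrite [e]splitr ltrD//; apply: le_lt_trans ne; apply: seq_dist_agree => i /qn.
by move=> ->.
Qed.

(** A base of the topology with countably many indices: [l] lists where the sequence is true among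
    the integers with code below [n]. *)
Definition basic (q : rat) (l : seq int) (n : nat) : set polish :=
  [set p | `|p.1 - ratr q| < n.+1%:R^-1 /\
           forall i, (choice.pickle i < n)%N -> p.2 i = (i \in l)].

Lemma basic_base (U : set polish) p : open U -> U p ->
  exists q l n, basic q l n p /\ basic q l n `<=` U.
Proof.
case: p => s x; rewrite openE => /(_ (s, x)) oU /oU /nbhs_ballP[e /= e0 eU].
(* One third each for the distances of [s] and [s'] to [q] and for the distance of the sequences. *)
have [n ne] : exists n : nat, n.+1%:R^-1 < e / 3 by apply: inv_nat_lt;
  rewrite divr_gt0.
have n0 : 0 < n.+1%:R^-1 :> R by rewrite invr_gt0.
have [q] : exists q : rat, ratr q \in `]s - n.+1%:R^-1, s + n.+1%:R^-1[.
  by apply: rat_in_itvoo; rewrite ltrBlDr -addrA ltrDl addr_gt0.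
rewrite in_itv/= => /andP[q1 q2].
pose l := [seq i <- pmap (@choice.unpickle int) (iota 0 n) | x i].
have inl i : (choice.pickle i < n)%N -> x i = (i \in l).
  move=> i_n; rewrite mem_filter; case: (x i) => //=; apply/esym.
  rewrite mem_pmap; apply/mapP; exists (choice.pickle i);
    last by rewrite choice.pickleK.
  by rewrite mem_iota.
have pq : `|s - ratr q| < n.+1%:R^-1 by rewrite ltr_distlC q1.
exists q, l, n; split => // -[s' x'] /= [s'q x'l]; apply/eU/ball_polishE.
have h : `|s - s'| <= `|s - ratr q| + `|s' - ratr q|.
  by rewrite [X in _ <= _ + X]distrC ler_distD.
have h' : seq_dist x x' <= n.+1%:R^-1.
  by apply: seq_dist_agree => i i_n; rewrite inl//; exact/esym/x'l.
have sum3 (a b c u : R) : a < c -> b < c -> c < u / 3 -> a + b + c < u by lra.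
by apply: le_lt_trans (lerD h h') _; exact: sum3 pq s'q ne.
Qed.

Lemma polish_separable : exists2 D : set polish, countable D & dense D.
Proof.
(* Rational first coordinate and finitely many true entries; [c (q, l)] lies in [basic q l n] for
   every [n]. *)
pose c (ql : rat * seq int) : polish := (ratr ql.1, fun i => i \in ql.2).
exists (range c); first by apply: sub_countable (card_image_le _ _) _.
move=> O [p Op] oO; have [q [l [n [_ bO]]]] := basic_base oO Op.
exists (c (q, l)); split; last by exists (q, l).
by apply: bO; split => //=; rewrite subrr normr0 invr_gt0.
Qed.

Local Notation space := (measurableTypeR R * coin_space)%type.

Lemma measurable_basic q l n : measurable (basic q l n : set space).
Proof.
have -> : (basic q l n : set space) =
    (fst @^-1` (ball (ratr q : R) n.+1%:R^-1 : set (measurableTypeR R))) `&`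
    ~` (\bigcup_(i in [set i | (choice.pickle i < n)%N])
         ~` [set p : space | p.2 i = (i \in l)]).
  apply/seteqP; split => p [p1 p2]; split.
  - by rewrite /ball/= distrC.
  - by case=> i /= /p2.
  - by rewrite distrC.
  - by move=> i i_n; apply: contrapT => h; apply: p2; exists i.
apply: measurableI.
  rewrite -[X in measurable X]setTI; apply: measurable_fst => //.
  exact: measurable_ball.
apply/measurableC/countType_bigcup_measurable => i _; apply: measurableC.
have [_|_] := boolP (i \in l); first exact: measurable_sequence.
rewrite (_ : [set p : space | _] = ~` [set p : space | p.2 i]).
  by apply: measurableC; exact: measurable_sequence.
by apply/seteqP; split => p /=; case: (p.2 i).
Qed.

(** Open sets are countable unions of basic sets, which are measurable in the product. Conversely,
    the generators of the product sigma-algebra, intervals and coordinate events, are open for the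
    metric. *)
Lemma standard_borel_space : standard_borel R space.
Proof.
exists polish, (fun p : space => p : polish); split.
- exact: polish_complete.
- exact: polish_separable.
- by exists (fun p : polish => p : space).
pose borel := g_sigma_algebraType (@open polish).
rewrite (_ : [set _ | B in <<s @open polish >>] = <<s @open polish >>);
  last first.
  by apply/seteqP; split => [_ [B oB <-]//|B oB]; exists B.
apply/seteqP; split => [A mA|]; last first.
  apply: smallest_sub; first exact: sigma_algebra_measurable.
  move=> U oU; have -> : U = \bigcup_(z in [set z : rat * seq int * nat |
      basic z.1.1 z.1.2 z.2 `<=` U]) basic z.1.1 z.1.2 z.2.
    apply/seteqP; split => [p Up|p [z /= zU /zU//]].
    by have [q [l [n [bp bU]]]] := basic_base oU Up; exists (q, l, n).
  by apply: countType_bigcup_measurable => z _; exact: measurable_basic.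
have mid : measurable_fun setT ((fun p : borel => p) : borel -> space).
  apply/measurable_fun_pairP; split.
    apply: (measurability _ (RGenOpens.measurableE R)) => _ [_ [a [b ->]] <-].
    rewrite setTI; apply: sub_sigma_algebra.
    rewrite openE => p /= pab; apply/nbhs_ballP.
    have : nbhs p.1 (`]a, b[%classic : set R) by apply: open_nbhs_nbhs; split.
    move=> /nbhs_ballP[e /= e0 eab]; exists e => // q /polish_ball_fst pq.
    by apply: eab.
  apply: measurable_to_coin_space => i; apply: sub_sigma_algebra.
  rewrite openE => p /= pi; apply/nbhs_ballP; exists (weight i);
    first exact: weight_gt0.
  by move=> q /polish_ball_snd/seq_dist_lt_weight pqi /=; rewrite -pqi.
by have := mid measurableT _ mA; rewrite setTI.
Qed.

End polish_model.

(** * The point process *)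

Section window.

Fixpoint window (n : nat) : seq int :=
  if n is m.+1 then n%:Z :: - n%:Z :: window m else [:: 0].

Lemma mem_window n k : (k \in window n) = (`|k| <= n)%N.
Proof. by elim: n => [|n IH]; rewrite /= !inE ?IH; lia. Qed.

Lemma window_uniq n : uniq (window n).
Proof. by elim: n => //= n ->; rewrite !inE !mem_window andbT; lia. Qed.

Lemma size_window n : size (window n) = n.*2.+1.
Proof. by elim: n => //= n ->. Qed.

(** Sites [(k, false)] are the even points, always kept; [(k, true)] is the odd point decided by
    coin [k]. *)
Definition occupied (x : coin_space) (j : int * bool) : bool := j.2 ==> x j.1.

Definition window_sites (x : coin_space) (n : nat) : seq (int * bool) :=
  [seq j <- [seq (k, b) | k <- window n, b <- [:: false; true]] | occupied x j].

Lemma mem_window_sites x n j :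
  (j \in window_sites x n) = (`|j.1| <= n)%N && occupied x j.
Proof.
rewrite mem_filter andbC; congr (_ && _); rewrite -mem_window; case: j => k b.
apply/allpairsPdep/idP => [[k' [b' [kn _ [-> _]]]]//|/= kn].
by exists k, b; split => //; case: b.
Qed.

Lemma window_sites_uniq x n : uniq (window_sites x n).
Proof.
rewrite filter_uniq// allpairs_uniq ?window_uniq//.
by move=> [k b] [k' b'] _ _ /= [-> ->].
Qed.

Lemma size_window_sites x n :
  size (window_sites x n) = (size (window n) + count x (window n))%N.
Proof.
rewrite /window_sites; elim: (window n) => [//|k s IH] /=.
by rewrite /= in IH; rewrite {1}/occupied /=; case: (x k) => /=; rewrite IH;
  lia.
Qed.

(** Four enlargements add eight integers, each carrying at most two points. *)
Lemma size_window_sites4 x n :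
  (size (window_sites x (n + 4)) <= size (window_sites x n) + 16)%N.
Proof.
rewrite !size_window_sites !size_window addn4 /=.
have b i : (x i <= 1)%N by exact: leq_b1.
have := b n.+4%:Z; have := b (- n.+4%:Z).
have := b n.+3%:Z; have := b (- n.+3%:Z).
have := b n.+2%:Z; have := b (- n.+2%:Z).
have := b n.+1%:Z; have := b (- n.+1%:Z).
rewrite !doubleS; lia.
Qed.

End window.

Section point_process.
Context {R : realType}.
Local Notation RT := (measurableTypeR R).
Local Notation space := (RT * coin_space)%type.

(* The even point 2(k + s) for b = false, the odd one above it for b = true. *)
Definition site (s : R) (j : int * bool) : R := 2 * (j.1%:~R + s) + j.2%:R.

Definition points (w : space) : set R :=
  [set site w.1 j | j in [set j | occupied w.2 j]].

Lemma site_sub (s : R) i j :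
  site s i - site s j = (2 * i.1 + (i.2 : nat)%:Z - (2 * j.1 + (j.2 :
    nat)%:Z))%:~R.
Proof. by rewrite /site !(intrB, intrD, intrM) -!pmulrn; lra. Qed.

Lemma site_inj (s : R) : injective (site s).
Proof.
move=> [k b] [l c] h; have := site_sub s (k, b) (l, c).
rewrite h subrr => /esym/eqP; rewrite intr_eq0 => /eqP /=.
by case: b h; case: c => _ /= e; congr pair; lia.
Qed.

Lemma site_bounded (s M : R) : exists n, forall j, `|site s j| <= M -> (`|j.1|
  <= n)%N.
Proof.
exists (Num.truncn (M + 2 * `|s| + 1)) => -[k b]; rewrite /site /= => h.
have hk : `|k|%:R <= M + 2 * `|s| + 1 :> R.
  rewrite natr_absz intr_norm.
  have b01 : 0 <= (b%:R : R) <= 1 by rewrite ler0n lern1 leq_b1.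
  have := ler_norm s; have := ler_norm (- s); rewrite normrN.
  move: h; rewrite !ler_norml => /andP[h1 h2] h3 h4.
  by apply/andP; split; lra.
by rewrite -ltnS -(ltr_nat R); apply: le_lt_trans hk _; exact: truncnS_gt.
Qed.

Lemma points_locally_finite w : locally_finite (points w).
Proof.
move=> K /compact_bounded[M [_ MK]]; have KM := MK (M + 1) (ltr_pwDr ltr01
  (lexx M)).
have [n jn] := site_bounded w.1 (M + 1).
apply: (@sub_finite_set _ _ (site w.1 @` [set` window_sites w.2 n])).
  move=> _ [[j /= xj <-] /KM /= /jn j_n]; exists j => //=.
  by rewrite mem_window_sites j_n.
by apply: finite_image; exact: finite_seq.
Qed.

Definition config (w : space) : lfset R := LFSet (points_locally_finite w).

Lemma config_flow t w : lfset_set (config (flow t w)) = translate (config w) t.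
Proof.
case: w => s x; rewrite /= /translate; apply/seteqP; split.
  (* The point labelled [k] after the flow carried the label [k - winding] before it. *)
  move=> _ [[k b] /= xk <-]; exists (site s (k - winding t (s, x), b)).
    by exists (k - winding t (s, x), b).
  by rewrite /site /= intrB; lra.
move=> _ [_ [[k b] /= xk <-] <-]; exists (k + winding t (s, x), b).
  by rewrite /= /occupied /= /shift addrK.
by rewrite /site /= intrD; lra.
Qed.

Lemma config_relatively_dense w : relatively_dense (config w).
Proof.
(* The even points alone have gaps of length 2. *)
exists `[0 : R, 2 : R]%classic; first exact: segment_compact.
apply/seteqP; split => // y _; pose k := Num.floor (y / 2 - w.1).
exists (site w.1 (k, false)); first by exists (k, false).
exists (y - site w.1 (k, false)); last by rewrite addrC subrK.
have /andP[] := floor_itv (y / 2 - w.1);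
  rewrite intrD1 -/k /site /= in_itv/= => h1 h2.
by apply/andP; split; lra.
Qed.

Lemma config_difference_set w z : difference_set (config w) z -> exists n :
  int, z = n%:~R.
Proof. by move=> [_ [i _ <-] [_ [j _ <-] <-]]; rewrite site_sub; eexists. Qed.

Lemma config_meyer w : meyer_set (config w).
Proof.
split; first exact: config_relatively_dense.
(* Differences of points are integers, hence distinct ones are at least 1 apart. *)
exists 1 => // y z /config_difference_set[m ->] /config_difference_set[n ->].
by rewrite eqr_int -intrB -intr_norm -[1]/(1%:~R) ler_int; lia.
Qed.

Lemma config_two_syndetic w : exists (t : R) (S : set int),
  two_syndetic S /\ translate (config w) t = [set n%:~R | n in S].
Proof.
exists (- (2 * w.1)), [set 2 * j.1 + (j.2 : nat)%:Z | j in [set j | occupied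
  w.2 j]].
split.
  (* The even integers and their translate by 1 already cover. *)
  exists 0, 1; apply/seteqP; split => // n _.
  have even_in k : [set 2 * j.1 + (j.2 : nat)%:Z | j in [set j | occupied w.2
    j]] (2 * k).
    by exists (k, false) => //=; rewrite addr0.
  have [k [nk|nk]] : exists k : int, n = 2 * k \/ n = 2 * k + 1.
    by exists (n %/ 2)%Z; lia.
  - by left; exists n; rewrite ?addr0// nk.
  - by right; exists (2 * k).
rewrite /translate /config/= /points; apply/seteqP; split => r /=.
  move=> [_ [j xj <-] <-]; exists (2 * j.1 + (j.2 : nat)%:Z); first by exists j.
  by rewrite /site intrD intrM -pmulrn; lra.
move=> [_ [j xj <-] <-]; exists (site w.1 j); first by exists j.
by rewrite /site intrD intrM -pmulrn; lra.
Qed.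

Lemma measurable_config : measurable_fun setT (config : space -> lfspace R).
Proof.
apply: (@measurability _ _ _ (lfspace R) setT config (@counting_events R)) =>
  //.
move=> _ [_ [B [n [mB _ ->]]] <-]; rewrite setTI.
pose E (j : int * bool) : set space := [set w | occupied w.2 j /\ B (site w.1
  j)].
have mE j : measurable (E j).
  rewrite (_ : E j = [set w : space | occupied w.2 j] `&` (fun w : space =>
    site w.1 j : RT) @^-1` B)//.
  apply: measurableI.
    case: j => k [] /=; first exact: measurable_sequence.
    by rewrite (_ : [set w : space | _] = setT)//; apply/seteqP; split.
  have msite : measurable_fun setT (fun w : space => site w.1 j : RT).
    apply: measurable_funD => //; apply: measurable_funM => //.
    by apply: measurable_funD => //; exact: measurable_fst.
  by have := msite measurableT _ mB; rewrite setTI.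
have pointsE w : points w `&` B = site w.1 @` [set j | E j w].
  apply/seteqP; split => [_ [[j xj <-] Bj]|_ [j [xj Bj] <-]]; first by exists j.
  by split => //; exists j.
have cardE w : (points w `&` B #= `I_n)%card = ([set j | E j w] #= `I_n)%card.
  by rewrite pointsE; apply: card_eql; apply: inj_card_eq => i j _ _;
    exact: site_inj.
(* Exactly [n] points fall in [B] when the set of labels of such points equals some finite [F] of
   size [n]. There are countably many [F], and each equality is a countable conjunction over
   labels. *)
have -> : config @^-1` [set S : lfset R | ((S : set R) `&` B #= `I_n)%card] =
    \bigcup_(F in [set F : {fset int * bool} | #|` F| = n])
      ~` (\bigcup_j [set w | ~ (E j w <-> j \in F)]).
  apply/seteqP; split => w /=.
    rewrite cardE => En; have finE : finite_set [set j | E j w] by exists n.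
    exists (fset_set [set j | E j w]); first exact: card_fset_set.
    by move=> [j _ /= h]; apply: h; rewrite in_fset_set// inE.
  move=> [F /= Fn EF]; rewrite cardE (_ : [set j | E j w] = [set` F]);
    last first.
    have h j : E j w <-> j \in F by apply: contrapT => ?; apply: EF; exists j.
    by apply/seteqP; split => j /h.
  exact/card_eq_fsetP.
apply: countType_bigcup_measurable => F _;
  apply/measurableC/countType_bigcup_measurable => j _.
have [jF|jF] := boolP (j \in F).
  rewrite (_ : [set w | _] = ~` E j); first exact: measurableC.
  by apply/seteqP; split => w /= h; [move=> Ejw; apply: h|move=> [_ h'];
    exact/h/h'].
rewrite (_ : [set w | _] = E j) //.
by apply/seteqP; split => w /= h; [apply: contrapT => nE;
  apply: h|move=> [h' _]; have := h' h].
Qed.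

Lemma meyerian_config : meyerian_point_process (@susp R) flow config.
Proof.
split.
- exact: standard_borel_space.
- exact: pmp_flow.
- exact: ergodic_flow.
- exact: measurable_config.
- by move=> t w; exact: config_flow.
- exact: config_meyer.
Qed.

End point_process.

(** * The number variance *)

Section variance_comparison.
Context d (T : measurableType d) (R : realType) (P : probability T R).

Lemma variance_ae_bounded (f : T -> R) (M : R) : measurable_fun setT f ->
  {ae P, forall x, `|f x| <= M} -> fine (variance P f) <= M ^+ 2.
Proof.
move=> mf fM; have f2 := Lfun2_ae_bounded mf fM.
rewrite -lee_fin fineK ?variance_fin_num// varianceE//.
apply: (@le_trans _ _ ('E_P[f ^+ 2])%E).
  by rewrite leeBlDr ?fin_numX ?expectation_fin_num ?Lfun_subset12
    ?fin_num_measure// leeDl// sqre_ge0.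
rewrite unlock; apply: (@le_trans _ _ (\int[P]_x (M ^+ 2)%:E)%E); last first.
  rewrite integral_cst// -[leRHS]mule1; apply: lee_wpmul2l;
    first by rewrite lee_fin sqr_ge0.
  exact: probability_le1.
apply: ae_ge0_le_integral; first exact: measurableT.
- by move=> x _; rewrite lee_fin sqr_ge0.
- by apply/measurable_EFinP; exact: (measurable_funX 2 mf).
- by move=> x _; rewrite lee_fin sqr_ge0.
- exact: measurable_cst.
- apply: filterS fM => x fxM _.
  have M0 := le_trans (normr_ge0 _) fxM; rewrite lee_fin -[leLHS]/(f x ^+ 2).
  by rewrite -[leLHS]real_normK ?num_real// ler_pXn2r ?nnegrE.
Qed.

(** The difference is [Var Y + 2 Cov(X, Y)], bounded by Cauchy-Schwarz. With [a] of order [sqrt r]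
    and [b] constant, the error is negligible against [r]. *)
Lemma variance_perturbation (X Y : T -> R) (a b : R) : 0 <= a -> 0 <= b ->
  X \in Lfun P 2%:E -> Y \in Lfun P 2%:E ->
  fine (variance P X) <= a ^+ 2 -> fine (variance P Y) <= b ^+ 2 ->
  `|fine (variance P (X \+ Y)) - fine (variance P X)| <= b ^+ 2 + 2 * (a * b).
Proof.
move=> a0 b0 X2 Y2 Xa Yb.
have Pfin : P setT \is a fin_num := fin_num_measure P _ measurableT.
have X1 := Lfun_subset12 Pfin X2.
have Y1 := Lfun_subset12 Pfin Y2.
have XY1 := Lfun2_mul_Lfun1 X2 Y2.
have cXY := covariance_fin_num X1 Y1 XY1.
have vX := variance_fin_num X2; have vY := variance_fin_num Y2.
have vY0 : 0 <= fine (variance P Y) by rewrite fine_ge0// variance_ge0.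
have vX0 : 0 <= fine (variance P X) by rewrite fine_ge0// variance_ge0.
have cab : `|fine (covariance P X Y)| <= a * b.
  rewrite -(@ler_sqr R) ?nnegrE ?mulr_ge0// real_normK ?num_real//.
  by rewrite (le_trans (covariance_sqr_le X2 Y2))// exprMn ler_pM.
have -> : fine (variance P (X \+ Y)) - fine (variance P X) =
    fine (variance P Y) + 2 * fine (covariance P X Y).
  rewrite varianceD// fineD ?fin_numD ?vX ?vY ?fin_numM// fineD// fineM//=.
  by rewrite addrAC [_ + fine (variance P Y)]addrC addrK.
apply: le_trans (ler_normD _ _) _; apply: lerD; first by rewrite ger0_norm.
by rewrite normrM ger0_norm// ler_pM2l.
Qed.

End variance_comparison.

(** * Comparison of the point count with a sum of fair coins *)

Section number_variance.
Context {R : realType}.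
Local Notation RT := (measurableTypeR R).
Local Notation space := (RT * coin_space)%type.
Local Notation N := (point_count (@config R)).

Lemma measurable_point_count (r : R) : measurable_fun setT (N r : space -> RT).
Proof.
have finP w : finite_set (points w `&` `[- r, r]).
  by apply: points_locally_finite; exact: segment_compact.
move=> _ Y mY; rewrite setTI.
have -> : N r @^-1` Y = \bigcup_(n in [set n : nat | Y (n%:R : R)])
    config @^-1` [set S : lfset R | ((S : set R) `&` `[- r, r] #= `I_n)%card].
  apply/seteqP; split => w; rewrite /point_count /=.
    by move=> Yw; have [n wn] := finP w; exists n => //=;
      rewrite -(card_fset_set wn).
  by move=> [n /= Yn wn]; rewrite (card_fset_set wn).
apply: countType_bigcup_measurable => n _.
rewrite -[X in measurable X]setTI; apply: (@measurable_config R) => //.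
apply: sub_sigma_algebra; exists `[- r, r]%classic, n; split => //.
by apply: compact_bounded; exact: segment_compact.
Qed.

(** A site with label [k] lies in [[2k, 2k + 3)]. Labels in [[-n, n]] thus stay within
    [2n + 4 <= r], while a point within [r < 2n + 6] has label at most [n + 4] in absolute value. *)
Lemma point_count_bounds (s r : R) (x : coin_space) (n : nat) : 0 <= s < 1 ->
  2 * (n%:R + 2) <= r < 2 * (n%:R + 3) ->
  (size (window_sites x n))%:R <= N r (s, x) <= (size (window_sites x (n +
    4)))%:R.
Proof.
move=> /andP[s0 s1] /andP[rn nr].
have finP : finite_set (points (s, x) `&` `[- r, r]).
  by apply: points_locally_finite; exact: segment_compact.
have b01 (b : bool) : 0 <= (b%:R : R) <= 1 by rewrite ler0n lern1 leq_b1.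
rewrite /point_count !ler_nat -!(size_map (site s)); apply/andP; split;
  apply: uniq_leq_size.
- by rewrite map_inj_uniq ?window_sites_uniq//; exact: site_inj.
- move=> _ /mapP[j + ->]; rewrite mem_window_sites => /andP[jn xj].
  rewrite in_fset_set// inE; split; first by exists j.
  move: jn; rewrite /= in_itv/= /site -(ler_nat R) natr_absz intr_norm
    ler_norml.
  by have := b01 j.2; move=> /andP[? ?] /andP[? ?]; apply/andP; split; lra.
- exact: fset_uniq.
- move=> y; rewrite in_fset_set// inE => -[[j xj <-]];
  rewrite /= in_itv/= => /andP[h1 h2].
  apply: map_f; rewrite mem_window_sites; apply/andP; split => //.
  move: h1 h2; rewrite /site /= => h1 h2; have /andP[c1 c2] := b01 j.2.
  suff : j.1 < n%:Z + 5 /\ - n%:Z - 5 < j.1 by lia.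
  rewrite -!(ltr_int R) !(intrD, intrN) -!pmulrn; split; lra.
Qed.

Lemma susp_setTX (A : set coin_space) : measurable A ->
  @susp R (setT `*` A) = @coin R A.
Proof.
move=> mA; apply: etrans; first exact: product_measure1E.
by rewrite -[RHS]mul1e; congr (_ * _)%E; exact: (probability_setT (@unif R)).
Qed.

Lemma ae_susp (Q : space -> Prop) :
  (forall (s : R) x, 0 <= s < 1 -> Q (s, x)) -> {ae @susp R, forall w, Q w}.
Proof.
move=> Q01; have mI := measurable_itv (`[0 : R, 1 : R[).
exists ((~` `[0 : R, 1 : R[%classic) `*` setT); split.
- by apply: measurableX => //; exact: measurableC.
- apply: etrans; first by apply: product_measure1E => //; exact: measurableC.
  by rewrite /= /unif /mrestr setICl measure0 mul0e.
- by move=> [s x] /= nQ; split => //; rewrite in_itv/= => /Q01.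
Qed.

Let B (k : int) : set space := [set w : space | w.2 k].

Let BE k : B k = setT `*` all_ones [fset k]%fset.
Proof.
apply/seteqP; split => [[s x] xk|[s x] [_ xk]].
  by split => // i; rewrite in_fset1 => /eqP ->.
by apply: xk; rewrite in_fset1.
Qed.

Let PB k : @susp R (B k) = (2^-1)%:E.
Proof.
rewrite BE; apply: etrans; first exact: susp_setTX (measurable_all_ones _).
by rewrite coin_all_ones cardfs1 expr1.
Qed.

Let PBI i j : i != j -> @susp R (B i `&` B j) = (@susp R (B i) * @susp R (B
  j))%E.
Proof.
move=> ij; rewrite !PB !BE -setXI setIT all_onesI.
apply: etrans; first exact: susp_setTX (measurable_all_ones _).
by rewrite coin_all_ones cardfsU1 cardfs1 in_fset1 ij -EFinM expr2.
Qed.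

Let mB k : measurable (B k).
Proof. exact: measurable_sequence. Qed.

(** The random part of the count: the number of odd points kept in the window. *)
Let Z n : space -> R := \sum_(k <- window n) \1_(B k).

Let ZE n w : Z n w = (count (w.2 : int -> bool) (window n))%:R.
Proof.
rewrite /Z fct_sumE; elim: (window n) => [|k s IH]; first by rewrite big_nil.
by rewrite big_cons /= natrD IH indicE; congr ((_ : bool)%:R + _);
  exact: asboolb.
Qed.

Let variance_Z n : fine (variance (@susp R) (Z n)) = (2 * n%:R + 1) / 4.
Proof.
rewrite variance_sum_indic ?window_uniq//.
have quarter : ((2^-1)%:E - (2^-1)%:E ^+ 2 = (4^-1)%:E :> \bar R)%E.
  by rewrite -EFin_expe -EFinB; congr EFin; lra.
rewrite (eq_bigr (fun=> (4^-1)%:E)); last first.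
  by move=> k _; rewrite -quarter; congr (_ - _ ^+ 2)%E; exact: PB.
rewrite sumEFin big_const_seq count_predT size_window iter_addr_0 /=.
by rewrite -[LHS]mulr_natl -addn1 -mul2n natrD natrM.
Qed.

(** The count is [Z n] plus a constant plus an error of size at most 16. The error costs
    [16^2 + 2 * 16 * sqrt r], and replacing [(2n + 1) / 4] by [r / 4] costs at most 5/4, whence
    258. *)
Lemma number_variance_bound (r : R) : 4 <= r ->
  number_variance (@susp R) config r \is a fin_num /\
  `|fine (number_variance (@susp R) config r) - r / 4| <= 258 + 32 * Num.sqrt r.
Proof.
move=> r4.
pose n := (Num.truncn (r / 2) - 2)%N.
have /andP[rn nr] : 2 * (n%:R + 2) <= r < 2 * (n%:R + 3).
  have r2 : 0 <= r / 2 by lra.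
  have t2 : (2 <= Num.truncn (r / 2))%N by rewrite truncn_ge_nat//; lra.
  have nE : (Num.truncn (r / 2))%:R = n%:R + 2 :> R by rewrite -natrD subnK.
  have := truncn_itv r2; rewrite -natr1 nE => /andP[h1 h2].
  by apply/andP; split; [move: h1|move: h2];
    rewrite ?ler_pdivlMr ?ltr_pdivrMr//; lra.
(* [c] is the number of even points with label in the window, so [Y] lies between [c] and [c + 16]
   almost surely. *)
pose c : R := 2 * n%:R + 1; pose Y : space -> R := N r \- Z n.
have mZ : measurable_fun setT (Z n).
  have := Lfun2_sum_indic (@susp R) (window n) mB.
  by rewrite inE => /andP[]; rewrite inE.
have mY : measurable_fun setT Y.
  by apply: measurable_funB => //; exact: measurable_point_count.
have Yc : {ae @susp R, forall w, `|(Y \- cst c) w| <= 16}.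
  apply: ae_susp => s x s01.
  have rnr : 2 * (n%:R + 2) <= r < 2 * (n%:R + 3) by rewrite rn.
  have /andP[lo hi] := point_count_bounds x s01 rnr.
  have := size_window_sites4 x n; rewrite -(ler_nat R) natrD => h4.
  move: lo hi h4; rewrite size_window_sites size_window /Y /= ZE /=.
  rewrite natrD -addn1 -mul2n natrD natrM /c => lo hi h4.
  by rewrite ger0_norm; lra.
have Z2 : Z n \in Lfun (@susp R) 2%:E := Lfun2_sum_indic _ _ mB.
have mYc : measurable_fun setT (Y \- cst c) by apply: measurable_funB.
have Yc2 : (Y \- cst c) \in Lfun (@susp R) 2%:E := Lfun2_ae_bounded mYc Yc.
have vY : fine (variance (@susp R) (Y \- cst c)) <= 16 ^+ 2 :=
  variance_ae_bounded mYc Yc.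
have NE : N r = (Z n \+ (Y \- cst c)) \+ cst c.
  by apply/funext => w; rewrite /Y /=; lra.
have ZY2 : (Z n \+ (Y \- cst c)) \in Lfun (@susp R) 2%:E.
  by rewrite rpredD ?lee1n.
rewrite /number_variance NE varianceD_cst_r//; split;
  first exact: variance_fin_num.
have r0 : 0 <= r by lra.
have vZ : fine (variance (@susp R) (Z n)) <= Num.sqrt r ^+ 2.
  by rewrite variance_Z sqr_sqrtr//; lra.
have := variance_perturbation (sqrtr_ge0 r) (ler0n R 16) Z2 Yc2 vZ vY.
rewrite variance_Z !ler_norml; lra.
Qed.

Lemma asymptotic_number_variance_config :
  has_asymptotic_number_variance (@susp R) config 8^-1.
Proof.
rewrite /has_asymptotic_number_variance; apply/fine_cvgP; split.
  near=> r; rewrite fin_numM//; apply: (number_variance_bound _).1.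
  by near: r; apply: nbhs_pinfty_ge; exact: num_real.
apply/cvgrPdist_lt => e e0; near=> r.
have r4 : 4 <= r by near: r; apply: nbhs_pinfty_ge; exact: num_real.
(* Since [sqrt r >= 1], the error [258 + 32 sqrt r] is at most [290 sqrt r]; divided by [2r] it is
   at most [145 / sqrt r]. The main term [r / 4] over [2r] is the limit 1/8. *)
have re : (145 / e) ^+ 2 < r by near: r; apply: nbhs_pinfty_gt; exact: num_real.
have [fV bV] := number_variance_bound r4.
rewrite /= fineM//=; move: bV; set V := fine _ => bV.
have r0 : 0 < r by lra.
have q0 : 0 < Num.sqrt r by rewrite sqrtr_gt0.
have qr : Num.sqrt r ^+ 2 = r by rewrite sqr_sqrtr// ltW.
have qe : 145 / e < Num.sqrt r.
  by rewrite -(@ltr_sqr R) ?nnegrE ?divr_ge0 ?ltW// qr.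
have q1 : 1 <= Num.sqrt r by rewrite -sqrtr1 ler_wsqrtr//; lra.
have -> : 8^-1 - V * (2 * r)^-1 = - (V - r / 4) / (2 * r) by field; lra.
rewrite normrM normrN [X in _ * X]ger0_norm; last by rewrite invr_ge0; lra.
rewrite ltr_pdivrMr; last by lra.
apply: (le_lt_trans bV); move: qe; rewrite ltr_pdivrMr// => qe.
have : 145 * Num.sqrt r < Num.sqrt r * e * Num.sqrt r by rewrite ltr_pM2r.
rewrite -{5}qr; set q := Num.sqrt r in q1 * => h.
have -> : e * (2 * q ^+ 2) = 2 * (q * e * q) by ring.
lra.
Unshelve. all: by end_near. Qed.

End number_variance.

Theorem theorem1p5 (R : realType) :
  exists (d : measure_display) (T : measurableType d) (P : probability T R)
         (act : R -> T -> T) (L : T -> lfset R),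
    [/\ meyerian_point_process P act L,
        two_syndetic_in_random_translate P L &
        exists2 v : R, 0 < v & has_asymptotic_number_variance P L v].
Proof.
exists _, _, (@susp R), flow, config; split.
- exact: meyerian_config.
- by apply: aeW => w; exact: config_two_syndetic.
- by exists 8^-1; [rewrite invr_gt0|exact: asymptotic_number_variance_config].
Qed.
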